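(* Let $X$ be a Banach space, $a_0\in\mathbb R\cup\{-\infty\}$, let $\mathcal T=\{T(t,s): t\ge s>a_0\}\subset\mathcal B(X)$ be an invertible evolution family, $h:(a_0,\infty)\to(0,\infty)$ a growth rate, and $a_0^*>a_0$ such that the following hold: (i) $\mathcal T$ exhibits $h$-bounded growth and $h$-bounded decay on $[a_0^*,\infty)$; (ii) there exists a finite-dimensional subspace $Z\subset X$ such that $X=\mathcal S\oplus Z$, where \[ \mathcal S:=\Big\{v\in X:\ \sup_{t\ge a_0^*}\|T(t,a_0^* )v\|<+\infty\Big\}. \] Then the following statements are equivalent: (a) $\mathcal T$ admits an $h$-dichotomy on $[a_0^*,\infty)$; (b) $\mathcal T$ is $h$-expansive on $[a_0^*,\infty)$; (c) $\mathcal T$ is uniformly $h$-noncritical on $[a_0^*,\infty)$.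
   Context: $X=(X,\|\cdot\|)$ is a Banach space and $\mathcal B(X)$ is the space of bounded linear operators on $X$ with the operator norm, also denoted $\|\cdot\|$; $\mathrm{Id}$ is the identity operator. Evolution family: for $a_0\in\mathbb R\cup\{-\infty\}$, a family $\mathcal T=\{T(t,s): t\ge s>a_0\}\subset\mathcal B(X)$ such that $T(t,t)=\mathrm{Id}$ for $t>a_0$; $T(t,s)T(s,r)=T(t,r)$ for $t\ge s\ge r>a_0$; and for every $s>a_0$ and $v\in X$ the map $t\mapsto T(t,s)v$ is continuous on $[s,\infty)$. It is invertible if each $T(t,s)$, $t\ge s>a_0$, is an invertible operator; in that case one sets $T(t,s):=T(s,t)^{-1}$ for $a_0<t<s$, so that $T(t,s)$ is defined for all $t,s>a_0$. Growth rate: a bijective increasing map $h:(a_0,\infty)\to(0,\infty)$. Let $J\subset(a_0,\infty)$ be an interval and $\mathcal T$ an invertible evolution family. $h$-bounded growth on $J$: there exist $K,\mu>0$ such that $\|T(t,s)\|\le K\left(\frac{h(t)}{h(s)}\right)^{\mu}$ for all $t,s\in J$ with $t\ge s$. $h$-bounded decay on $J$: there exist $K,\mu>0$ such that $\|T(t,s)\|\le K\left(\frac{h(s)}{h(t)}\right)^{\mu}$ for all $t,s\in J$ with $t\le s$. $h$-dichotomy on $J$: there exist a family $\{P(t):t\in J\}$ of bounded projections on $X$ and constants $D,\lambda>0$ such that: (1) for $t,s\in J$ with $t\ge s$, $P(t)T(t,s)=T(t,s)P(s)$ and $T(t,s)|_{\operatorname{Ker}P(s)}:\operatorname{Ker}P(s)\to\operatorname{Ker}P(t)$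 is invertible; (2) $\|T(t,s)P(s)\|\le D\left(\frac{h(t)}{h(s)}\right)^{-\lambda}$ for $t,s\in J$, $t\ge s$; (3) $\|T(t,s)(\mathrm{Id}-P(s))\|\le D\left(\frac{h(s)}{h(t)}\right)^{-\lambda}$ for $t,s\in J$, $t\le s$, where here $T(t,s):=(T(s,t)|_{\operatorname{Ker}P(t)})^{-1}:\operatorname{Ker}P(s)\to\operatorname{Ker}P(t)$. $h$-expansive on $J$: there exist $L,\beta>0$ such that \[ \|v\|\le L\left(\left(\frac{h(t)}{h(a)}\right)^{-\beta}\|T(a,t)v\|+\left(\frac{h(b)}{h(t)}\right)^{-\beta}\|T(b,t)v\|\right) \] for all $v\in X$ and all $a\le t\le b$ with $[a,b]\subset J$. Uniformly $h$-noncritical on $[a_0^*,\infty)$: there exist $\theta\in(0,1)$ and $C>0$ such that $\|v\|\le\theta\sup\{\|T(u,t)v\|: |\ln h(u)-\ln h(t)|\le C\}$ for all $v\in X$ and all $t$ such that $h(t)\ge e^{C}h(a_0^* )$. *)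

(* Defs.v *)
From Stdlib Require Import Reals ClassicalEpsilon.
From Coquelicot Require Import Coquelicot.
Open Scope R_scope.

(* The operator norm takes values in [Rbar], so a bound on it also asserts
   that it is finite. *)
Definition opnorm {K : AbsRing} {X : NormedModule K} (f : X -> X) : Rbar :=
  Lub_Rbar (fun r => exists v : X, norm v <= 1 /\ r = norm (f v)).

Definition Ker {K : AbsRing} {X : NormedModule K} (f : X -> X) (v : X) : Prop :=
  f v = zero.

Definition invertible_op {K : AbsRing} {X : NormedModule K} (f : X -> X) : Prop :=
  exists g : X -> X,
    is_linear g /\ (forall v, g (f v) = v) /\ (forall v, f (g v) = v).

Definition maps_bijectively {X : Type} (A B : X -> Prop) (f : X -> X) : Prop :=
  (forall v, A v -> B (f v)) /\
  (forall w, B w -> exists! v, A v /\ f v = w).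

(* [inverse_on A f w] is the preimage of [w] in [A] under [f] when that
   preimage exists and is unique, and an unspecified vector otherwise. *)
Definition inverse_on {K : AbsRing} {X : NormedModule K}
    (A : X -> Prop) (f : X -> X) (w : X) : X :=
  epsilon (inhabits zero) (fun v => A v /\ f v = w).

(* Only the values [T t s] with [a0 < s <= t] are part of the family: the values
   of the total function [T] elsewhere are unconstrained and never used. *)
Definition evolution_family {K : AbsRing} {X : NormedModule K}
    (a0 : Rbar) (T : R -> R -> X -> X) : Prop :=
  (forall t s : R, Rbar_lt a0 s -> s <= t -> is_linear (T t s)) /\
  (forall (t : R) v, Rbar_lt a0 t -> T t t v = v) /\
  (forall (t s r : R) v, Rbar_lt a0 r -> r <= s -> s <= t ->
     T t s (T s r v) = T t r v) /\
  (forall (s : R) v, Rbar_lt a0 s -> continuous_on (fun t => s <= t) (fun t => T t s v)).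

Definition invertible_family {K : AbsRing} {X : NormedModule K}
    (a0 : Rbar) (T : R -> R -> X -> X) : Prop :=
  forall t s : R, Rbar_lt a0 s -> s <= t -> invertible_op (T t s).

(* The family extended to t < s by T(t,s) := T(s,t)^{-1}. *)
Definition ext {K : AbsRing} {X : NormedModule K}
    (T : R -> R -> X -> X) (t s : R) : X -> X :=
  if Rle_dec s t then T t s else inverse_on (fun _ => True) (T s t).

(* "Increasing" is strict, which is where injectivity of [h] comes from. *)
Definition growth_rate (a0 : Rbar) (h : R -> R) : Prop :=
  (forall t : R, Rbar_lt a0 t -> 0 < h t) /\
  (forall s t : R, Rbar_lt a0 s -> s < t -> h s < h t) /\
  (forall y, 0 < y -> exists t : R, Rbar_lt a0 t /\ h t = y).

Definition bounded_growth {K : AbsRing} {X : NormedModule K}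
    (h : R -> R) (T : R -> R -> X -> X) (J : R -> Prop) : Prop :=
  exists M mu : R, 0 < M /\ 0 < mu /\
    forall t s : R, J t -> J s -> s <= t ->
      Rbar_le (opnorm (T t s)) (M * Rpower (h t / h s) mu).

Definition bounded_decay {K : AbsRing} {X : NormedModule K}
    (h : R -> R) (T : R -> R -> X -> X) (J : R -> Prop) : Prop :=
  exists M mu : R, 0 < M /\ 0 < mu /\
    forall t s : R, J t -> J s -> t <= s ->
      Rbar_le (opnorm (ext T t s)) (M * Rpower (h s / h t) mu).

Definition projection {K : AbsRing} {X : NormedModule K} (P : X -> X) : Prop :=
  is_linear P /\ forall v, P (P v) = P v.

Definition dichotomy {K : AbsRing} {X : NormedModule K}
    (h : R -> R) (T : R -> R -> X -> X) (J : R -> Prop) : Prop :=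
  exists (P : R -> X -> X) (D lambda : R), 0 < D /\ 0 < lambda /\
    (forall t : R, J t -> projection (P t)) /\
    (forall t s : R, J t -> J s -> s <= t ->
       (forall v, P t (T t s v) = T t s (P s v)) /\
       maps_bijectively (Ker (P s)) (Ker (P t)) (T t s)) /\
    (forall t s : R, J t -> J s -> s <= t ->
       Rbar_le (opnorm (fun v => T t s (P s v)))
               (D * Rpower (h t / h s) (- lambda))) /\
    (forall t s : R, J t -> J s -> t <= s ->
       Rbar_le (opnorm (fun v => inverse_on (Ker (P t)) (T s t) (minus v (P s v))))
               (D * Rpower (h s / h t) (- lambda))).

Definition expansive {K : AbsRing} {X : NormedModule K}
    (h : R -> R) (T : R -> R -> X -> X) (J : R -> Prop) : Prop :=
  exists L beta : R, 0 < L /\ 0 < beta /\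
    forall (v : X) (a t b : R), a <= t -> t <= b -> (forall u, a <= u <= b -> J u) ->
      norm v <= L * (Rpower (h t / h a) (- beta) * norm (ext T a t v)
                     + Rpower (h b / h t) (- beta) * norm (ext T b t v)).

(* [u] and [t] range over (a0, +oo), the domain of [h]; the inequalities on [h]
   then place both in [a0s, +oo). *)
Definition uniformly_noncritical {K : AbsRing} {X : NormedModule K}
    (a0 : Rbar) (h : R -> R) (T : R -> R -> X -> X) (a0s : R) : Prop :=
  exists theta C : R, 0 < theta < 1 /\ 0 < C /\
    forall (v : X) (t : R), Rbar_lt a0 t -> exp C * h a0s <= h t ->
      Rbar_le (norm v)
        (Rbar_mult theta
           (Lub_Rbar (fun r => exists u : R, Rbar_lt a0 u /\
                        Rabs (ln (h u) - ln (h t)) <= C /\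
                        r = norm (ext T u t v)))).

Definition bounded_orbits {K : AbsRing} {X : NormedModule K}
    (T : R -> R -> X -> X) (a0s : R) (v : X) : Prop :=
  Rbar_lt (Lub_Rbar (fun r => exists t : R, a0s <= t /\ r = norm (T t a0s v))) p_infty.

Fixpoint span {K : AbsRing} {X : NormedModule K} (l : list X) (v : X) : Prop :=
  match l with
  | nil => v = zero
  | cons e l' => exists (c : K) (w : X), span l' w /\ v = plus (scal c e) w
  end.

Definition finite_dim_subspace {K : AbsRing} {X : NormedModule K}
    (Z : X -> Prop) : Prop :=
  exists l : list X, forall v, Z v <-> span l v.

Definition direct_sum {K : AbsRing} {X : NormedModule K} (A B : X -> Prop) : Prop :=
  (forall v, exists a b, A a /\ B b /\ v = plus a b) /\
  (forall v, A v -> B v -> v = zero).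

(* Main.v *)
(* A dichotomy bounds the stable part of [v] by its past and the unstable part by its
   future, which is expansivity; and expansivity on a window [|ln h(u) - ln h(t)| <= C]
   with [C] large is noncriticality.

   For the return from noncriticality to a dichotomy, measure time by [ln h]. Along a
   bounded orbit, noncriticality shrinks the supremum over the future by [theta] each
   time [C] elapses, and bounded growth compares that supremum with the present value:
   so [S] decays exponentially. Along an orbit starting in [Z], the norm up to time [s]
   is controlled by its values at the two ends of the interval; since all these orbits
   are unbounded and [Z] is finite-dimensional, there is a time, common to all of [Z], by
   which each has grown so much that only the right end matters, and iterating
   noncriticality gives exponential growth. These two rates force a lower bound on the
   angle between the images of [S] and [Z], so the projections along [T(t, a0s) Z] onto
   [T(t, a0s) S] are uniformly bounded. *)

Require Import Defs.
From Stdlib Require Import Reals Lra Lia ClassicalEpsilon.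
From Coquelicot Require Import Coquelicot.
Open Scope R_scope.

(** * Nonnegative functions satisfying a noncriticality condition *)

Lemma exp_le_exp (x y : R) : x <= y -> exp x <= exp y.
Proof.
  intros [H| ->]; [left; now apply exp_increasing|right; reflexivity].
Qed.

(** Turns contraction by [theta] per step of length [C] into exponential decay at rate
    [- ln theta / C]. The factor [/ theta] pays for the last, incomplete step, since [x] may exceed
    [INR n * C] by up to [C]. *)
Lemma pow_le_exp (theta C x : R) (n : nat) :
  0 < theta < 1 -> 0 < C -> x <= (INR n + 1) * C ->
  theta ^ n <= / theta * exp (- (- ln theta / C) * x).
Proof.
  intros Ht HC Hx.
  rewrite <- Rpower_pow by lra. unfold Rpower.
  replace (/ theta) with (exp (- ln theta)) by (rewrite exp_Ropp, exp_ln; lra).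
  rewrite <- exp_plus.
  assert (Hl : ln theta < 0) by (rewrite <- ln_1; apply ln_increasing; lra).
  apply exp_le_exp.
  assert (H : - ln theta * (x / C) <= - ln theta * (INR n + 1)).
  { apply Rmult_le_compat_l; [lra|].
    apply Rmult_le_reg_r with C; [lra|].
    replace (x / C * C) with x by (field; lra). lra. }
  replace (- (- ln theta / C) * x) with (- (- ln theta * (x / C))) by (field; lra).
  nra.
Qed.

Lemma nfloor_mul (C x : R) : 0 < C -> 0 <= x ->
  exists n : nat, INR n * C <= x <= (INR n + 1) * C.
Proof.
  intros HC Hx.
  destruct (nfloor_ex (x / C)) as [n Hn].
  { apply Rdiv_le_0_compat; lra. }
  exists n. replace x with (x / C * C) by (field; lra).
  split; apply Rmult_le_compat_r; lra.
Qed.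

(** * Decay of bounded noncritical functions, and control by the ends of an interval *)

Section NoncriticalFunction.

Variables (f : R -> R) (t0 theta C E : R).
Hypothesis f_pos : forall t, 0 <= f t.
Hypothesis theta01 : 0 < theta < 1.
Hypothesis C_pos : 0 < C.
Hypothesis E_ge1 : 1 <= E.
Hypothesis f_growth : forall s t, t0 <= s -> t0 <= t -> Rabs (t - s) <= C -> f t <= E * f s.
Hypothesis f_noncritical : forall t B, t0 + C <= t ->
  (forall u, Rabs (u - t) <= C -> f u <= B) -> f t <= theta * B.

(** Let [m] be the supremum of [f] over the future of [s]. Values within [C] of [s] are at most
    [E * f s] by growth, all later ones at most [theta * m] by noncriticality; as [theta < 1], the
    later ones cannot determine [m] unless [m <= 0]. *)
Lemma bounded_le_start (B0 s t : R) :
  (forall u, t0 <= u -> f u <= B0) -> t0 <= s -> s <= t -> f t <= E * f s.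
Proof.
  intros HB Hs Ht.
  destruct (completeness (fun r => exists u, s <= u /\ r = f u)) as [m [Hub Hlub]].
  - exists B0. intros r [u [Hu ->]]. apply HB; lra.
  - exists (f s), s. split; [lra|easy].
  - assert (Hf : forall u, s <= u -> f u <= m) by (intros u Hu; apply Hub; now exists u).
    assert (Hm : m <= Rmax (E * f s) (theta * m)).
    { apply Hlub. intros r [u [Hu ->]].
      destruct (Rle_dec u (s + C)) as [Hc|Hc].
      - eapply Rle_trans; [|apply Rmax_l]. apply f_growth; try lra.
        rewrite Rabs_pos_eq; lra.
      - eapply Rle_trans; [|apply Rmax_r]. apply f_noncritical; [lra|].
        intros w Hw. apply Hf. apply Rabs_le_between in Hw. lra. }
    assert (Hm0 : f t <= m) by now apply Hf.
    pose proof (f_pos s). pose proof (f_pos t).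
    assert (0 <= E * f s) by nra.
    revert Hm. apply Rmax_case; intros Hm; [lra|].
    assert (m <= 0) by nra. lra.
Qed.

(** A time beyond [s + INR (S n) * C] has its whole window beyond [s + INR n * C], so each use of
    noncriticality gains one factor [theta]. *)
Lemma bounded_decay_steps (s B : R) (n : nat) :
  t0 <= s -> (forall u, s <= u -> f u <= B) ->
  forall t, s + INR n * C <= t -> f t <= theta ^ n * B.
Proof.
  intros Hs HB. induction n as [|n IH]; intros t Ht.
  - simpl in *. rewrite Rmult_1_l. apply HB. lra.
  - rewrite S_INR in Ht. simpl. rewrite Rmult_assoc.
    pose proof (pos_INR n).
    apply f_noncritical; [nra|].
    intros u Hu. apply Rabs_le_between in Hu. apply IH. nra.
Qed.

Lemma bounded_exp_decay (B0 s t : R) :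
  (forall u, t0 <= u -> f u <= B0) -> t0 <= s -> s <= t ->
  f t <= E / theta * exp (- (- ln theta / C) * (t - s)) * f s.
Proof.
  intros HB Hs Ht.
  destruct (nfloor_mul C (t - s)) as [n Hn]; [lra|lra|].
  apply Rle_trans with (theta ^ n * (E * f s)).
  - apply bounded_decay_steps with s; [easy| |lra].
    intros u Hu. now apply bounded_le_start with B0.
  - pose proof (pow_le_exp theta C (t - s) n theta01 C_pos (proj2 Hn)) as Hp.
    apply Rmult_le_compat_r with (r := E * f s) in Hp; [|pose proof (f_pos s); nra].
    eapply Rle_trans; [exact Hp|]. right. unfold Rdiv. ring.
Qed.

(** The supremum argument of [bounded_le_start] on a compact interval: points farther than [C] from
    both ends cannot determine a positive supremum, and growth compares every other point with an
    end within distance [C]. *)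
Lemma le_max_ends (s t : R) :
  t0 <= t -> t <= s -> f t <= E * Rmax (f s) (f t0).
Proof.
  intros Ht Hs.
  destruct (completeness (fun r => exists u, t0 <= u <= s /\ r = f u)) as [m [Hub Hlub]].
  - (* [f] is bounded on [t0, s] because [s] is reached in finitely many steps of length [C] *)
    assert (H : forall n u, t0 <= u <= t0 + INR n * C -> f u <= E ^ n * f t0).
    { induction n as [|n IH]; intros u Hu.
      - simpl in *. replace u with t0 by lra. lra.
      - rewrite S_INR in Hu. simpl.
        destruct (Rle_dec u (t0 + INR n * C)) as [Hc|Hc].
        + specialize (IH u (conj (proj1 Hu) Hc)). pose proof (f_pos u). nra.
        + pose proof (pos_INR n).
          assert (H1 : f u <= E * f (t0 + INR n * C)).
          { apply f_growth; try nra. rewrite Rabs_pos_eq; lra. }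
          specialize (IH (t0 + INR n * C)).
          assert (H2 : f (t0 + INR n * C) <= E ^ n * f t0) by (apply IH; nra).
          nra. }
    destruct (nfloor_mul C (s - t0)) as [n Hn]; [lra|lra|].
    exists (E ^ S n * f t0). intros r [u [Hu ->]]. apply H. rewrite S_INR. lra.
  - exists (f t), t. split; [lra|easy].
  - assert (Hf : forall u, t0 <= u <= s -> f u <= m) by (intros u Hu; apply Hub; now exists u).
    set (w := E * Rmax (f s) (f t0)).
    assert (Hw1 : E * f s <= w) by (apply Rmult_le_compat_l; [lra|apply Rmax_l]).
    assert (Hw2 : E * f t0 <= w) by (apply Rmult_le_compat_l; [lra|apply Rmax_r]).
    assert (Hm : m <= Rmax w (theta * m)).
    { apply Hlub. intros r [u [Hu ->]].
      destruct (Rle_dec u (t0 + C)) as [Hc|Hc].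
      - eapply Rle_trans; [|apply Rmax_l].
        eapply Rle_trans; [|exact Hw2]. apply f_growth; try lra. rewrite Rabs_pos_eq; lra.
      - destruct (Rle_dec (s - C) u) as [Hc'|Hc'].
        + eapply Rle_trans; [|apply Rmax_l].
          eapply Rle_trans; [|exact Hw1]. apply f_growth; try lra. rewrite Rabs_left1; lra.
        + eapply Rle_trans; [|apply Rmax_r]. apply f_noncritical; [lra|].
          intros v Hv. apply Hf. apply Rabs_le_between in Hv. lra. }
    assert (Hm0 : f t <= m) by (apply Hf; lra).
    pose proof (f_pos s). pose proof (f_pos t).
    assert (0 <= w) by nra.
    revert Hm. apply Rmax_case; intros Hm; [lra|].
    assert (m <= 0) by nra. lra.
Qed.

(** * Exponential growth once [f] has exceeded a fixed multiple of its initial value *)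

Section Unbounded.

Variables (t1 G : R).
Hypothesis t01 : t0 <= t1.
Hypothesis G_ge1 : 1 <= G.
Hypothesis f_start : forall s, t0 <= s <= t1 -> f t0 <= G * f s.
Hypothesis f_exceeds : exists u, t0 <= u <= t1 /\ E * E / theta * f t0 < f u.

(** Apply [le_max_ends] on [[t0, s]] at the time [u] of [f_exceeds]. There [f u] is too large to be
    bounded by [E * f t0], so it is bounded by [E * f s]; one of the two factors [E] in the
    threshold cancels. *)
Lemma start_le_late (s : R) : t1 <= s -> E * f t0 <= theta * f s.
Proof.
  intros Hs. destruct f_exceeds as [u [Hu Hfu]].
  pose proof (le_max_ends s u (proj1 Hu)) as H.
  specialize (H ltac:(lra)).
  pose proof (f_pos t0) as P0. pose proof (f_pos s) as Ps.
  assert (Hq : theta * (E * E / theta * f t0) = E * E * f t0) by (field; lra).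
  set (q := E * E / theta * f t0) in *.
  revert H. apply Rmax_case; intros H.
  - assert (Hx : E * (E * f t0) <= E * (theta * f s)) by nra.
    apply Rmult_le_reg_l in Hx; lra.
  - exfalso.
    assert (theta * q < theta * (E * f t0)) by (apply Rmult_lt_compat_l; lra).
    assert (0 <= E * f t0) by nra. nra.
Qed.

Lemma le_end (s t : R) : t0 <= t -> t <= s -> f t <= E * G * f s.
Proof.
  intros Ht Hs.
  pose proof (le_max_ends s t Ht Hs) as H.
  pose proof (f_pos t0) as P0. pose proof (f_pos s) as Ps.
  assert (H0 : f t0 <= G * f s).
  { destruct (Rle_dec s t1) as [Hc|Hc]; [apply f_start; lra|].
    pose proof (start_le_late s ltac:(lra)). nra. }
  revert H. rewrite Rmult_assoc. apply Rmax_case; intros H;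
    (eapply Rle_trans; [exact H|]); apply Rmult_le_compat_l; nra.
Qed.

Lemma unbounded_decay_steps (n : nat) : forall s t : R,
  t1 + INR n * C <= s -> t0 <= t -> t <= s - INR n * C ->
  f t <= theta ^ n * (E * G * f s).
Proof.
  intros s. induction n as [|n IH]; intros t Hs Ht Hts.
  - simpl in *. rewrite Rmult_1_l. apply le_end; lra.
  - rewrite S_INR in Hs, Hts. simpl. rewrite Rmult_assoc.
    set (s' := s - INR n * C). pose proof (pos_INR n).
    assert (HB : forall u, t0 <= u <= s' -> f u <= theta ^ n * (E * G * f s)).
    { intros u Hu. apply IH; unfold s' in *; try lra. }
    destruct (Rle_dec t (t0 + C)) as [Hc|Hc].
    + apply Rle_trans with (E * f t0).
      { apply f_growth; try lra. rewrite Rabs_pos_eq; lra. }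
      apply Rle_trans with (theta * f s').
      { apply start_le_late. unfold s'. lra. }
      apply Rmult_le_compat_l; [lra|]. apply HB. unfold s'. lra.
    + apply f_noncritical; [lra|]. intros u Hu. apply Rabs_le_between in Hu.
      apply HB. unfold s'. lra.
Qed.

(** Contraction steps are available only after [t1]; the factor [exp ((- ln theta / C) * (t1 - t0))]
    compensates for the waiting time. *)
Lemma unbounded_exp_growth (s t : R) : t0 <= t -> t <= s ->
  f t <= E * G / theta * exp ((- ln theta / C) * (t1 - t0))
         * exp (- (- ln theta / C) * (s - t)) * f s.
Proof.
  intros Ht Hs.
  pose proof (f_pos s) as Ps.
  assert (HEG : 1 <= E * G) by nra.
  assert (Hn : exists n : nat, f t <= theta ^ n * (E * G * f s) /\
                s - t - (t1 - t0) <= (INR n + 1) * C).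
  { destruct (Rle_dec (Rmax t t1) s) as [Hc|Hc].
    - destruct (nfloor_mul C (s - Rmax t t1)) as [n Hn]; [lra|lra|].
      pose proof (Rmax_l t t1). pose proof (Rmax_r t t1).
      exists n. split; [apply unbounded_decay_steps; lra|].
      assert (Rmax t t1 <= t + (t1 - t0)) by (apply Rmax_lub; lra). lra.
    - exists 0%nat. split; simpl.
      + rewrite Rmult_1_l. now apply le_end.
      + revert Hc. apply Rmax_case; lra. }
  destruct Hn as [n [H1 H2]].
  pose proof (pow_le_exp theta C _ n theta01 C_pos H2) as Hp.
  apply Rmult_le_compat_r with (r := E * G * f s) in Hp; [|nra].
  eapply Rle_trans; [exact H1|]. eapply Rle_trans; [exact Hp|]. right.
  replace (- (- ln theta / C) * (s - t - (t1 - t0)))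
    with ((- ln theta / C) * (t1 - t0) + - (- ln theta / C) * (s - t)) by ring.
  rewrite exp_plus. unfold Rdiv. ring.
Qed.

End Unbounded.
End NoncriticalFunction.

(** * Normed spaces over the real or complex numbers *)

(** The limit superior is a cluster point: [phi n] is chosen to be an index at least [n] whose value
    lies within [/ (INR n + 1)] of it. *)
Lemma real_bounded_subseq (u : nat -> R) (B : R) : (forall n, Rabs (u n) <= B) ->
  exists (phi : nat -> nat) (l : R), filterlim phi eventually eventually /\
    is_lim_seq (fun n => u (phi n)) l.
Proof.
  intros HB.
  assert (HB' : forall n, - B <= u n <= B) by (intros n; apply Rabs_le_between, HB).
  destruct (ex_LimSup_seq u) as [[l| |] Hl].
  - assert (H : forall n : nat, exists m, (n <= m)%nat /\ Rabs (u m - l) < / (INR n + 1)).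
    { intros n. pose proof (RinvN_pos n) as Hpos.
      destruct (Hl (mkposreal _ Hpos)) as [H1 [N H2]]. simpl in *.
      destruct (H1 (max n N)) as [m [Hm Hum]]. exists m. split; [lia|].
      specialize (H2 m ltac:(lia)). apply Rabs_lt_between. lra. }
    set (phi := fun n => proj1_sig (constructive_indefinite_description _ (H n))).
    assert (Hphi : forall n, (n <= phi n)%nat /\ Rabs (u (phi n) - l) < / (INR n + 1)).
    { intros n. exact (proj2_sig (constructive_indefinite_description _ (H n))). }
    exists phi, l. split.
    + intros P [N HN]. exists N. intros n Hn. apply HN.
      pose proof (proj1 (Hphi n)). lia.
    + apply is_lim_seq_spec. intros eps.
      destruct (archimed_cor1 eps (cond_pos eps)) as [N [HN HN0]].
      exists N. intros n Hn. eapply Rlt_trans; [apply Hphi|].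
      eapply Rle_lt_trans; [|exact HN].
      apply Rinv_le_contravar; [now apply lt_0_INR|].
      apply le_INR in Hn. lra.
  - destruct (Hl B 0%nat) as [n [_ Hn]]. specialize (HB' n). lra.
  - destruct (Hl (- B)) as [N HN]. specialize (HN N (Nat.le_refl N)).
    specialize (HB' N). lra.
Qed.

(* What is used of the scalars, and holds for both [R] and [C]. *)
Definition locally_compact_valued_field (K : AbsRing) : Prop :=
  (forall r : R, 0 <= r -> exists c : K, abs c = r) /\
  (forall c : K, c <> zero -> exists c' : K, mult c' c = one /\ abs c' * abs c = 1) /\
  (forall (c : nat -> K) (B : R), (forall n, abs (c n) <= B) ->
     exists (phi : nat -> nat) (l : K), filterlim phi eventually eventually /\
       is_lim_seq (fun n => abs (minus (c (phi n)) l)) 0).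

Lemma R_locally_compact : locally_compact_valued_field R_AbsRing.
Proof.
  split; [|split].
  - intros r Hr. exists r. now apply Rabs_pos_eq.
  - intros c Hc. exists (/ c). unfold mult, one, abs, zero in *; simpl in *.
    split; [now field|]. rewrite <- Rabs_mult, Rinv_l by easy. apply Rabs_R1.
  - intros c B HB. destruct (real_bounded_subseq c B HB) as [phi [l [Hphi Hl]]].
    exists phi, l. split; [easy|].
    apply is_lim_seq_abs_0 with (u := fun n => c (phi n) - l).
    replace (Finite 0) with (Finite (l - l)) by (f_equal; ring).
    apply is_lim_seq_minus'; [easy|apply is_lim_seq_const].
Qed.

Lemma C_locally_compact : locally_compact_valued_field C_AbsRing.
Proof.
  split; [|split].
  - intros r Hr. exists (RtoC r). unfold abs; simpl. rewrite Cmod_R. now apply Rabs_pos_eq.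
  - intros c Hc. exists (Cinv c). unfold mult, one, abs, zero in *; simpl in *.
    split; [now apply Cinv_l|]. rewrite <- Cmod_mult, Cinv_l by easy. apply Cmod_1.
  - intros c B HB.
    destruct (real_bounded_subseq (fun n => Re (c n)) B) as [phi [l [Hphi Hl]]].
    { intros n. eapply Rle_trans; [apply re_le_Cmod|apply HB]. }
    (* A further extraction keeps the real parts convergent. *)
    destruct (real_bounded_subseq (fun n => Im (c (phi n))) B) as [psi [l' [Hpsi Hl']]].
    { intros n. eapply Rle_trans; [|apply (HB (phi n))].
      eapply Rle_trans; [apply Rmax_r|apply Rmax_Cmod]. }
    exists (fun n => phi (psi n)), (l, l'). split.
    { exact (filterlim_comp _ _ _ _ _ _ _ _ Hpsi Hphi). }
    apply is_lim_seq_le_le with (u := fun _ => 0)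
      (w := fun n => Rabs (Re (c (phi (psi n))) - l) + Rabs (Im (c (phi (psi n))) - l')).
    + intros n. split; [apply abs_ge_0|].
      unfold abs, minus, plus, opp; simpl.
      replace (Cplus (c (phi (psi n))) (Copp (l, l')))
        with (Cplus (RtoC (Re (c (phi (psi n))) - l))
                    (Cmult Ci (RtoC (Im (c (phi (psi n))) - l')))).
      * eapply Rle_trans; [apply Cmod_triangle|].
        rewrite Cmod_mult, !Cmod_R. apply Rplus_le_compat_l.
        replace (Cmod Ci) with 1; [lra|].
        unfold Cmod, Ci; simpl. rewrite <- sqrt_1 at 1. f_equal. ring.
      * destruct (c (phi (psi n))) as [x y].
        unfold Cplus, Cmult, Copp, RtoC, Re, Im, Ci; simpl. f_equal; ring.
    + apply is_lim_seq_const.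
    + replace (Finite 0) with (Finite (0 + 0)) by (f_equal; ring).
      apply is_lim_seq_plus'.
      * apply (is_lim_seq_abs_0 (fun n => Re (c (phi (psi n))) - l)).
        replace (Finite 0) with (Finite (l - l)) by (f_equal; ring).
        apply is_lim_seq_minus'; [|apply is_lim_seq_const].
        exact (is_lim_seq_subseq _ _ psi Hpsi Hl).
      * apply (is_lim_seq_abs_0 (fun n => Im (c (phi (psi n))) - l')).
        replace (Finite 0) with (Finite (l' - l')) by (f_equal; ring).
        apply is_lim_seq_minus'; [easy|apply is_lim_seq_const].
Qed.

Section NormedSpace.

Context {K : AbsRing} {X : NormedModule K}.

(* [scal_zero_l] and its companions, restated at the structure instances that
   elaboration picks in a normed module, where the originals do not rewrite. *)
Lemma scal_zero_normed (v : X) : scal (zero : K) v = (zero : X).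
Proof.
  exact (scal_zero_l v).
Qed.

Lemma scal_plus_normed (a b : K) (v : X) : scal (plus a b) v = plus (scal a v) (scal b v) :> X.
Proof.
  exact (scal_distr_r a b v).
Qed.

Lemma scal_minus_normed (a b : K) (v : X) :
  scal (minus a b) v = minus (scal a v) (scal b v) :> X.
Proof.
  exact (scal_minus_distr_r a b v).
Qed.

Lemma scal_minus_r_normed (c : K) (v w : X) :
  scal c (minus v w) = minus (scal c v) (scal c w) :> X.
Proof.
  exact (scal_minus_distr_l c v w).
Qed.

Lemma minus_eq_zero_normed (v : X) : minus v v = (zero : X).
Proof.
  exact (minus_eq_zero v).
Qed.

Lemma plus_minus (a v : X) : plus a (minus v a) = v.
Proof.
  unfold minus. rewrite (plus_comm v), plus_assoc.
  etransitivity; [exact (f_equal (fun w => plus w v) (plus_opp_r a))|apply plus_zero_l].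
Qed.

Lemma minus_plus_l (a b : X) : minus (plus a b) a = b.
Proof.
  unfold minus. rewrite (plus_comm a b), <- plus_assoc.
  etransitivity; [exact (f_equal (plus b) (plus_opp_r a))|apply plus_zero_r].
Qed.

Lemma minus_scal_opp (v w : X) : minus v w = plus v (scal (opp (one : K)) w).
Proof.
  exact (f_equal (plus v) (eq_sym (scal_opp_one w))).
Qed.

Lemma minus_minus (v a b : X) : minus (minus v a) (minus v b) = minus b a.
Proof.
  transitivity (plus (minus v a) (minus b v)).
  - exact (f_equal (plus (minus v a)) (opp_minus v b)).
  - rewrite plus_comm. exact (eq_sym (minus_trans v b a)).
Qed.

Lemma plus_plus_swap (a b c d : X) : plus (plus a b) (plus c d) = plus (plus a c) (plus b d).
Proof.
  rewrite <- !plus_assoc. f_equal. rewrite !plus_assoc. f_equal. apply plus_comm.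
Qed.

Lemma minus_plus_plus (a b c d : X) :
  minus (plus a b) (plus c d) = plus (minus a c) (minus b d).
Proof.
  transitivity (plus (plus a b) (plus (opp c) (opp d))).
  - exact (f_equal (plus (plus a b)) (opp_plus c d)).
  - apply plus_plus_swap.
Qed.

Hypothesis hK : locally_compact_valued_field K.

(** The reverse inequality is [norm_scal] for the inverse [c'], whose absolute value is exactly the
    inverse of [abs c]. *)
Lemma norm_scal_eq (c : K) (v : X) : norm (scal c v) = abs c * norm v.
Proof.
  destruct (excluded_middle_informative (c = zero)) as [->|Hc].
  { rewrite scal_zero_normed, norm_zero, abs_zero. ring. }
  destruct (proj1 (proj2 hK) c Hc) as [c' [H1 H2]].
  apply Rle_antisym; [apply norm_scal|].
  replace v with (scal c' (scal c v)) at 1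
    by (rewrite scal_assoc, H1; apply scal_one).
  pose proof (norm_scal c' (scal c v)). pose proof (abs_ge_0 c).
  apply Rle_trans with (abs c * (abs c' * norm (scal c v))).
  - now apply Rmult_le_compat_l.
  - right. rewrite <- (Rmult_1_l (norm (scal c v))) at 2. rewrite <- H2. ring.
Qed.

Lemma exists_normalizing_scalar (v : X) :
  v <> zero -> exists c : K, abs c = / norm v /\ norm (scal c v) = 1.
Proof.
  intros Hv.
  assert (Hn : 0 < norm v).
  { destruct (norm_ge_0 v) as [H|H]; [easy|]. now elim Hv; apply norm_eq_zero. }
  destruct (proj1 hK (/ norm v)) as [c Hc].
  { left. now apply Rinv_0_lt_compat. }
  exists c. split; [easy|]. rewrite norm_scal_eq, Hc. field. lra.
Qed.

Lemma opnorm_le (f : X -> X) (M : R) :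
  0 <= M -> (forall v, norm (f v) <= M * norm v) -> Rbar_le (opnorm f) M.
Proof.
  intros HM Hf. apply Lub_Rbar_correct. intros r [v [Hv ->]]. simpl.
  specialize (Hf v). nra.
Qed.

(** Rescaling to the unit sphere. Asking only for homogeneity lets this apply to [ext] and
    [inverse_on] maps without first proving them [is_linear]. *)
Lemma opnorm_bound (f : X -> X) (M : R) :
  (forall c v, f (scal c v) = scal c (f v)) -> Rbar_le (opnorm f) M ->
  forall v, norm (f v) <= M * norm v.
Proof.
  intros Hf HM v.
  destruct (excluded_middle_informative (v = zero)) as [->|Hv].
  { assert (H0 : f zero = zero).
    { rewrite <- (scal_zero_normed zero) at 1. rewrite Hf. apply scal_zero_normed. }
    rewrite H0, norm_zero. lra. }
  destruct (exists_normalizing_scalar v Hv) as [c [Hc Hn]].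
  assert (H : Rbar_le (norm (f (scal c v))) M).
  { eapply Rbar_le_trans; [|exact HM]. apply Lub_Rbar_correct.
    exists (scal c v). split; [lra|easy]. }
  simpl in H. rewrite Hf, norm_scal_eq, Hc in H.
  assert (Hpos : 0 < norm v).
  { destruct (norm_ge_0 v) as [Hp|Hp]; [easy|]. now elim Hv; apply norm_eq_zero. }
  apply Rmult_le_compat_l with (r := norm v) in H; [|lra].
  rewrite <- Rmult_assoc, Rinv_r in H; lra.
Qed.

Lemma span_plus (l : list X) (v w : X) : span l v -> span l w -> span l (plus v w).
Proof.
  revert v w. induction l as [|e l IH]; simpl; intros v w.
  - intros -> ->. apply plus_zero_l.
  - intros [c [v' [Hv ->]]] [d [w' [Hw ->]]].
    exists (plus c d), (plus v' w'). split; [now apply IH|].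
    rewrite scal_plus_normed. apply plus_plus_swap.
Qed.

Lemma span_scal (l : list X) (k : K) (v : X) : span l v -> span l (scal k v).
Proof.
  revert v. induction l as [|e l IH]; simpl; intros v.
  - intros ->. exact (scal_zero_r k).
  - intros [c [w [Hw ->]]]. exists (mult k c), (scal k w). split; [now apply IH|].
    rewrite scal_distr_l, scal_assoc. reflexivity.
Qed.

Lemma norm_minus_le (v w : X) : norm (minus v w) <= norm v + norm w.
Proof.
  eapply Rle_trans; [apply norm_triangle|]. rewrite norm_opp. lra.
Qed.

Lemma norm_le_minus (v w : X) : norm v <= norm w + norm (minus v w).
Proof.
  rewrite <- (plus_minus w v) at 1. apply norm_triangle.
Qed.

Lemma norm_le_plus (v w : X) : norm w <= norm (plus v w) + norm v.
Proof.
  rewrite <- (minus_plus_l v w) at 1. apply norm_minus_le.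
Qed.

Lemma norm_minus_sym (v w : X) : norm (minus v w) = norm (minus w v).
Proof.
  rewrite <- norm_opp, opp_minus. reflexivity.
Qed.

(* Bolzano-Weierstrass, by induction on the spanning list: if the new vector [e]
   is outside [span l], its distance to [span l] is positive (by the induction
   hypothesis), so the [e]-coefficients of a bounded sequence are bounded. *)
Lemma span_bounded_subseq (l : list X) : forall (z : nat -> X) (B : R),
  (forall n, span l (z n)) -> (forall n, norm (z n) <= B) ->
  exists (phi : nat -> nat) (y : X), filterlim phi eventually eventually /\
    span l y /\ is_lim_seq (fun n => norm (minus (z (phi n)) y)) 0.
Proof.
  induction l as [|e l IH]; intros z B Hz HB.
  { exists (fun n => n), zero. split; [apply filterlim_id|]. split; [easy|].
    apply is_lim_seq_ext with (fun _ => 0); [|apply is_lim_seq_const].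
    intros n. rewrite (Hz n), minus_eq_zero_normed, norm_zero. reflexivity. }
  destruct (excluded_middle_informative (span l e)) as [He|He].
  { assert (Hsp : forall v, span (e :: l) v <-> span l v).
    { intros v. split.
      - intros [c [w [Hw ->]]]. apply span_plus; [now apply span_scal|easy].
      - intros Hv. exists zero, v. split; [easy|].
        rewrite scal_zero_normed, plus_zero_l. reflexivity. }
    destruct (IH z B) as [phi [y [H1 [H2 H3]]]]; [intros n; now apply Hsp|easy|].
    exists phi, y. now rewrite Hsp. }
  assert (Hd : exists d, 0 < d /\ forall w, span l w -> d <= norm (plus e w)).
  { apply NNPP. intros Hno.
    (* At distance zero, vectors [w n] of [span l] would approach the opposite of [e]; the limit [y]
       of a subsequence satisfies [plus e y = zero], which puts [e] in [span l]. *)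
    assert (Hw : forall n : nat, exists w, span l w /\ norm (plus e w) < / (INR n + 1)).
    { intros n. apply NNPP. intros Hn. apply Hno. exists (/ (INR n + 1)).
      split; [apply RinvN_pos|]. intros w Hw. apply Rnot_lt_le. intros Hlt.
      apply Hn. now exists w. }
    set (w := fun n => proj1_sig (constructive_indefinite_description _ (Hw n))).
    assert (Hws : forall n, span l (w n) /\ norm (plus e (w n)) < / (INR n + 1)).
    { intros n. exact (proj2_sig (constructive_indefinite_description _ (Hw n))). }
    destruct (IH w (norm e + 1)) as [phi [y [H1 [H2 H3]]]].
    { apply Hws. }
    { intros n. rewrite <- (minus_plus_l e (w n)).
      eapply Rle_trans; [apply norm_minus_le|].
      destruct (Hws n) as [_ Hn].
      assert (/ (INR n + 1) <= / 1).
      { apply Rinv_le_contravar; [lra|]. pose proof (pos_INR n). lra. }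
      rewrite Rinv_1 in *. lra. }
    apply He.
    assert (Hey : plus e y = zero).
    { apply norm_eq_zero.
      assert (Hlim : is_lim_seq (fun n => / (INR (phi n) + 1) + norm (minus (w (phi n)) y)) 0).
      { replace (Finite 0) with (Finite (0 + 0)) by (f_equal; ring).
        apply is_lim_seq_plus'; [|easy].
        apply (is_lim_seq_subseq (fun n => / (INR n + 1)) 0 phi H1).
        apply is_lim_seq_spec. intros eps.
        destruct (archimed_cor1 eps (cond_pos eps)) as [N [HN HN0]].
        exists N. intros n Hn. rewrite Rminus_0_r, Rabs_pos_eq
          by (left; apply RinvN_pos).
        eapply Rle_lt_trans; [|exact HN].
        apply Rinv_le_contravar; [now apply lt_0_INR|]. apply le_INR in Hn. lra. }
      apply Rle_antisym; [|apply norm_ge_0].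
      apply (is_lim_seq_le (fun _ => norm (plus e y)) _ (norm (plus e y)) 0)
        with (3 := Hlim); [|apply is_lim_seq_const].
      intros n. eapply Rle_trans; [apply (norm_le_minus _ (plus e (w (phi n))))|].
      rewrite minus_plus_plus, minus_eq_zero_normed, plus_zero_l, norm_minus_sym.
      apply Rplus_le_compat_r. left. apply Hws. }
    replace e with (scal (opp one) y).
    { now apply span_scal. }
    rewrite scal_opp_one. apply (plus_reg_r y). exact (eq_trans (plus_opp_l y) (eq_sym Hey)). }
  destruct Hd as [d [Hd0 Hd]].
  assert (Hcw : forall n, exists cw : K * X, span l (snd cw) /\
                  z n = plus (scal (fst cw) e) (snd cw)).
  { intros n. destruct (Hz n) as [c [w [H1 H2]]]. now exists (c, w). }
  set (cw := fun n => proj1_sig (constructive_indefinite_description _ (Hcw n))).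
  assert (Hs : forall n, span l (snd (cw n)) /\
                 z n = plus (scal (fst (cw n)) e) (snd (cw n))).
  { intros n. exact (proj2_sig (constructive_indefinite_description _ (Hcw n))). }
  set (c := fun n => fst (cw n)). set (w := fun n => snd (cw n)).
  (* For nonzero [c n], multiplying [z n] by the inverse gives [e] plus a vector of [span l], of
     norm at least [d]; hence [abs (c n) * d <= norm (z n)]. *)
  assert (Hc : forall n, abs (c n) <= B / d).
  { intros n. destruct (Hs n) as [H1 H2]. specialize (HB n).
    apply Rmult_le_reg_r with d; [easy|].
    replace (B / d * d) with B by (field; lra).
    eapply Rle_trans; [|exact HB]. rewrite H2. fold (c n) (w n) in *.
    destruct (excluded_middle_informative (c n = zero)) as [H0|H0].
    { rewrite H0, abs_zero, Rmult_0_l. apply norm_ge_0. }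
    destruct (proj1 (proj2 hK) (c n) H0) as [c' [E1 E2]].
    assert (Hx : scal c' (plus (scal (c n) e) (w n)) = plus e (scal c' (w n))).
    { rewrite scal_distr_l, scal_assoc, E1, scal_one. reflexivity. }
    specialize (Hd _ (span_scal l c' _ H1)). rewrite <- Hx, norm_scal_eq in Hd.
    pose proof (abs_ge_0 (c n)).
    apply Rle_trans with (abs (c n) * (abs c' * norm (plus (scal (c n) e) (w n)))).
    - now apply Rmult_le_compat_l.
    - rewrite <- Rmult_assoc, (Rmult_comm (abs (c n))), E2. lra. }
  destruct (proj2 (proj2 hK) c (B / d) Hc) as [phi [c0 [Hphi Hc0]]].
  destruct (IH (fun n => w (phi n)) (B + B / d * norm e)) as [psi [y [Hpsi [Hy Hlim]]]].
  { intros n. apply Hs. }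
  { intros n.
    assert (Hw : w (phi n) = minus (z (phi n)) (scal (c (phi n)) e)).
    { rewrite (proj2 (Hs (phi n))). symmetry. apply minus_plus_l. }
    rewrite Hw.
    eapply Rle_trans; [apply norm_minus_le|].
    apply Rplus_le_compat; [apply HB|].
    eapply Rle_trans; [apply norm_scal|].
    apply Rmult_le_compat_r; [apply norm_ge_0|apply Hc]. }
  exists (fun n => phi (psi n)), (plus (scal c0 e) y). split; [|split].
  - exact (filterlim_comp _ _ _ _ _ _ _ _ Hpsi Hphi).
  - now exists c0, y.
  - apply is_lim_seq_le_le with (u := fun _ => 0)
      (w := fun n => abs (minus (c (phi (psi n))) c0) * norm e
                     + norm (minus (w (phi (psi n))) y)).
    + intros n. split; [apply norm_ge_0|].
      destruct (Hs (phi (psi n))) as [_ H2]. rewrite H2.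
      fold (c (phi (psi n))) (w (phi (psi n))).
      rewrite minus_plus_plus, <- scal_minus_normed.
      eapply Rle_trans; [apply norm_triangle|].
      apply Rplus_le_compat_r, norm_scal.
    + apply is_lim_seq_const.
    + replace (Finite 0) with (Finite (0 * norm e + 0)) by (f_equal; ring).
      apply is_lim_seq_plus'; [|exact Hlim].
      apply is_lim_seq_mult'; [|apply is_lim_seq_const].
      exact (is_lim_seq_subseq _ _ psi Hpsi Hc0).
Qed.

End NormedSpace.

(** * The evolution family extended to all pairs of times *)

Section Additive.

Context {K : AbsRing} {X : NormedModule K}.

Lemma inverse_on_eq (A : X -> Prop) (f : X -> X) (v w : X) :
  A v -> f v = w -> (forall u, A u -> f u = w -> u = v) -> inverse_on A f w = v.
Proof.
  intros HA Hf Huniq. unfold inverse_on.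
  destruct (epsilon_spec (inhabits zero) (fun u => A u /\ f u = w)) as [H1 H2].
  - now exists v.
  - now apply Huniq.
Qed.

Lemma additive_minus (f : X -> X) (v w : X) :
  (forall x y, f (plus x y) = plus (f x) (f y)) -> f (minus v w) = minus (f v) (f w).
Proof.
  intros Hf. rewrite <- (plus_minus w v) at 2. rewrite Hf. symmetry. apply minus_plus_l.
Qed.

Lemma additive_zero (f : X -> X) :
  (forall x y, f (plus x y) = plus (f x) (f y)) -> f zero = zero.
Proof.
  intros Hf. rewrite <- (minus_eq_zero_normed zero) at 1.
  rewrite (additive_minus f) by easy. apply minus_eq_zero_normed.
Qed.

End Additive.

Section Evolution.

Context {K : AbsRing} {X : NormedModule K}.
Variables (a0 : Rbar) (T : R -> R -> X -> X).
Hypothesis hT : evolution_family a0 T.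
Hypothesis hTinv : invertible_family a0 T.

Lemma evolution_plus (t s : R) (v w : X) :
  Rbar_lt a0 s -> s <= t -> T t s (plus v w) = plus (T t s v) (T t s w).
Proof.
  intros Hs Hst. exact (linear_plus _ (proj1 hT t s Hs Hst) v w).
Qed.

Lemma evolution_scal (t s : R) (c : K) (v : X) :
  Rbar_lt a0 s -> s <= t -> T t s (scal c v) = scal c (T t s v).
Proof.
  intros Hs Hst. exact (linear_scal _ (proj1 hT t s Hs Hst) c v).
Qed.

Lemma evolution_inj (t s : R) (v w : X) :
  Rbar_lt a0 s -> s <= t -> T t s v = T t s w -> v = w.
Proof.
  intros Hs Hst H. destruct (hTinv t s Hs Hst) as [g [_ [Hg _]]].
  rewrite <- (Hg v), H. apply Hg.
Qed.

Lemma ext_le (t s : R) : s <= t -> ext T t s = T t s.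
Proof.
  intros H. unfold ext. now destruct (Rle_dec s t).
Qed.

(* Together with injectivity of [T q t], this determines [ext T t s] for any order of
   [t] and [s]; the algebraic laws of [ext T] follow from it by taking [q] large. *)
Lemma evolution_ext (q t s : R) (v : X) :
  Rbar_lt a0 t -> Rbar_lt a0 s -> t <= q -> s <= q -> T q t (ext T t s v) = T q s v.
Proof.
  intros Ht Hs Htq Hsq. destruct hT as [_ [_ [Hc _]]].
  unfold ext. destruct (Rle_dec s t) as [H|H].
  - now apply Hc.
  - rewrite <- (Hc q s t) by (try easy; lra). f_equal.
    destruct (hTinv s t Ht ltac:(lra)) as [g [_ [_ Hg]]].
    rewrite (inverse_on_eq _ _ (g v) v); [easy|easy|easy|].
    intros u _ Hu. apply (evolution_inj s t); [easy|lra|]. now rewrite Hu, Hg.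
Qed.

Lemma ext_unique (q t s : R) (v w : X) :
  Rbar_lt a0 t -> Rbar_lt a0 s -> t <= q -> s <= q -> T q t w = T q s v -> ext T t s v = w.
Proof.
  intros Ht Hs Htq Hsq H. apply (evolution_inj q t); [easy|easy|].
  now rewrite evolution_ext.
Qed.

Lemma ext_refl (t : R) (v : X) : Rbar_lt a0 t -> ext T t t v = v.
Proof.
  intros Ht. rewrite ext_le by lra. now apply hT.
Qed.

Lemma ext_comp (t s r : R) (v : X) :
  Rbar_lt a0 t -> Rbar_lt a0 s -> Rbar_lt a0 r -> ext T t s (ext T s r v) = ext T t r v.
Proof.
  intros Ht Hs Hr. set (q := Rmax t (Rmax s r)).
  assert (Hq1 : t <= q) by apply Rmax_l.
  assert (Hq2 : s <= q) by (eapply Rle_trans; [apply Rmax_l|apply Rmax_r]).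
  assert (Hq3 : r <= q) by (eapply Rle_trans; [apply Rmax_r|apply Rmax_r]).
  apply (ext_unique q); try easy. now rewrite !evolution_ext.
Qed.

Lemma ext_plus (t s : R) (v w : X) : Rbar_lt a0 t -> Rbar_lt a0 s ->
  ext T t s (plus v w) = plus (ext T t s v) (ext T t s w).
Proof.
  intros Ht Hs. pose proof (Rmax_l t s). pose proof (Rmax_r t s).
  apply (ext_unique (Rmax t s)); try easy.
  now rewrite !evolution_plus, !evolution_ext.
Qed.

Lemma ext_scal (t s : R) (c : K) (v : X) : Rbar_lt a0 t -> Rbar_lt a0 s ->
  ext T t s (scal c v) = scal c (ext T t s v).
Proof.
  intros Ht Hs. pose proof (Rmax_l t s). pose proof (Rmax_r t s).
  apply (ext_unique (Rmax t s)); try easy.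
  now rewrite !evolution_scal, !evolution_ext.
Qed.

Lemma ext_minus (t s : R) (v w : X) : Rbar_lt a0 t -> Rbar_lt a0 s ->
  ext T t s (minus v w) = minus (ext T t s v) (ext T t s w).
Proof.
  intros Ht Hs. apply additive_minus. intros x y. now apply ext_plus.
Qed.

(* The inverse on [Ker (P t)] occurring in the definition of a dichotomy agrees with
   the global inverse [ext T t s]. *)
Lemma inverse_on_Ker (P : R -> X -> X) (t s : R) (v : X) :
  Rbar_lt a0 t -> t <= s -> projection (P t) ->
  (forall w, P s (T s t w) = T s t (P t w)) ->
  inverse_on (Ker (P t)) (T s t) (minus v (P s v))
  = minus (ext T t s v) (P t (ext T t s v)).
Proof.
  intros Ht Hts [Hlin Hidem] Hcomm.
  assert (Hs : Rbar_lt a0 s) by (eapply Rbar_lt_le_trans; [exact Ht|exact Hts]).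
  set (u := ext T t s v).
  assert (Hu : T s t u = v).
  { unfold u. rewrite evolution_ext by (try easy; lra). now apply hT. }
  assert (Hm : T s t (minus u (P t u)) = minus v (P s v)).
  { rewrite additive_minus by (intros; now apply evolution_plus).
    now rewrite <- Hcomm, Hu. }
  apply inverse_on_eq.
  - unfold Ker. rewrite additive_minus by (intros; now apply Hlin).
    rewrite Hidem. apply minus_eq_zero_normed.
  - exact Hm.
  - intros w _ Hw. apply (evolution_inj s t); [easy|easy|]. now rewrite Hw, Hm.
Qed.

End Evolution.

Lemma Rpower_ratio (x y z : R) : 0 < x -> 0 < y ->
  Rpower (x / y) z = exp (z * (ln x - ln y)).
Proof.
  intros Hx Hy. unfold Rpower, Rdiv. f_equal.
  rewrite ln_mult, ln_Rinv by (try apply Rinv_0_lt_compat; easy). ring.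
Qed.

(** * From expansivity and noncriticality to a dichotomy *)

Section EvolutionWithRate.

Context {K : AbsRing} {X : NormedModule K}.
Hypothesis hK : locally_compact_valued_field K.
Variables (a0 : Rbar) (T : R -> R -> X -> X).
Hypothesis hT : evolution_family a0 T.
Hypothesis hTinv : invertible_family a0 T.
Variable h : R -> R.
Hypothesis hh : growth_rate a0 h.
Variable a0s : R.
Hypothesis ha0s : Rbar_lt a0 a0s.

Lemma domain_of_le (t : R) : a0s <= t -> Rbar_lt a0 t.
Proof.
  intros Ht. eapply Rbar_lt_le_trans; [exact ha0s|exact Ht].
Qed.

Lemma h_pos (t : R) : a0s <= t -> 0 < h t.
Proof.
  intros Ht. apply hh. now apply domain_of_le.
Qed.

Lemma h_le_inv (s t : R) : Rbar_lt a0 t -> h s <= h t -> s <= t.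
Proof.
  intros Ht H. destruct (Rle_dec s t) as [Hc|Hc]; [easy|].
  pose proof (proj1 (proj2 hh) t s Ht ltac:(lra)). lra.
Qed.

Lemma h_le (s t : R) : Rbar_lt a0 s -> s <= t -> h s <= h t.
Proof.
  intros Hs [H| ->]; [|lra]. left. now apply hh.
Qed.

Lemma ln_h_le (s t : R) : a0s <= s -> s <= t -> ln (h s) <= ln (h t).
Proof.
  intros Hs Hst. apply ln_le; [now apply h_pos|]. apply h_le; [|easy]. now apply domain_of_le.
Qed.

(** The forward estimate, applied to the past value [ext T a t v], bounds [P t v]; the backward one,
    applied to the future value [ext T b t v], bounds [minus v (P t v)]. So [D] and [lambda] serve
    as [L] and [beta]. *)
Lemma dichotomy_expansive :
  dichotomy h T (fun t => a0s <= t) -> expansive h T (fun t => a0s <= t).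
Proof.
  intros [P [D [lambda [HD [Hl [Hproj [Hinv [HS HU]]]]]]]].
  exists D, lambda. split; [easy|]. split; [easy|].
  intros v a t b Hat Htb HJ.
  assert (Ja : a0s <= a) by (apply HJ; lra).
  assert (Jt : a0s <= t) by lra. assert (Jb : a0s <= b) by lra.
  pose proof (domain_of_le _ Ja) as Da. pose proof (domain_of_le _ Jt) as Dt.
  pose proof (domain_of_le _ Jb) as Db.
  assert (H1 : norm (P t v) <= D * Rpower (h t / h a) (- lambda) * norm (ext T a t v)).
  { replace (P t v) with (T t a (P a (ext T a t v))).
    - apply (opnorm_bound hK (fun w => T t a (P a w))); [|now apply HS].
      intros c w. rewrite (linear_scal _ (proj1 (Hproj a Ja))).
      now apply (evolution_scal a0).
    - rewrite <- (proj1 (Hinv t a Jt Ja Hat)).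
      rewrite (evolution_ext a0) by (try easy; lra). f_equal. now apply hT. }
  assert (H2 : norm (minus v (P t v))
               <= D * Rpower (h b / h t) (- lambda) * norm (ext T b t v)).
  { pose proof (fun w => inverse_on_Ker a0 T hT hTinv P t b w Dt Htb (Hproj t Jt)
                  (proj1 (Hinv b t Jb Jt Htb))) as Hi.
    pose proof (Hi (ext T b t v)) as Hv.
    rewrite (ext_comp a0), (ext_refl a0) in Hv by easy. rewrite <- Hv.
    apply (opnorm_bound hK (fun w => inverse_on (Ker (P t)) (T b t) (minus w (P b w))));
      [|now apply HU].
    intros c w. rewrite !Hi, (ext_scal a0) by easy.
    rewrite (linear_scal _ (proj1 (Hproj t Jt))). symmetry. apply scal_minus_r_normed. }
  pose proof (norm_le_minus v (P t v)). lra.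
Qed.

Lemma expansive_noncritical :
  expansive h T (fun t => a0s <= t) -> uniformly_noncritical a0 h T a0s.
Proof.
  intros [L [beta [HL [Hb H]]]].
  (* This choice gives [4 * L * exp (- beta * C) <= 1], so the two terms of expansivity add up to at
     most half the supremum; the added [1] keeps [C] positive. *)
  set (C := (Rabs (ln (4 * L)) + 1) / beta).
  pose proof (Rabs_pos (ln (4 * L))).
  assert (HC : 0 < C) by (apply Rdiv_lt_0_compat; lra).
  assert (HLC : 4 * L * exp (- beta * C) <= 1).
  { rewrite <- (exp_ln (4 * L)) by lra. rewrite <- exp_plus, <- exp_0.
    apply exp_le_exp. unfold C. pose proof (Rle_abs (ln (4 * L))).
    replace (- beta * ((Rabs (ln (4 * L)) + 1) / beta)) with (- (Rabs (ln (4 * L)) + 1))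
      by (field; lra). lra. }
  exists (1 / 2), C. split; [lra|]. split; [easy|].
  intros v t Ht Hth.
  pose proof (proj1 hh t Ht) as Hht.
  pose proof (exp_pos C). pose proof (exp_pos (- C)).
  (* Surjectivity of [h] supplies the times at logarithmic distance exactly [C] before and after
     [t]; the lower bound on [h t] keeps the earlier one in [[a0s, +oo)]. *)
  destruct (proj2 (proj2 hh) (exp (- C) * h t)) as [a [Ha Hha]]; [nra|].
  destruct (proj2 (proj2 hh) (exp C * h t)) as [b [Hb' Hhb]]; [nra|].
  assert (HCC : exp (- C) * exp C = 1) by (rewrite <- exp_plus, Rplus_opp_l; apply exp_0).
  assert (Ja : a0s <= a).
  { apply h_le_inv; [easy|]. rewrite Hha. nra. }
  assert (HC1 : 1 <= exp C) by (rewrite <- exp_0; apply exp_le_exp; lra).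
  assert (Hat : a <= t) by (apply h_le_inv; [easy|]; rewrite Hha; nra).
  assert (Htb : t <= b) by (apply h_le_inv; [easy|]; rewrite Hhb; nra).
  assert (Hla : ln (h a) = - C + ln (h t)) by (rewrite Hha, ln_mult, ln_exp; easy).
  assert (Hlb : ln (h b) = C + ln (h t)) by (rewrite Hhb, ln_mult, ln_exp; easy).
  specialize (H v a t b Hat Htb ltac:(intros; lra)).
  rewrite !Rpower_ratio in H by (try easy; rewrite ?Hha, ?Hhb; nra).
  replace (- beta * (ln (h t) - ln (h a))) with (- beta * C) in H by (rewrite Hla; ring).
  replace (- beta * (ln (h b) - ln (h t))) with (- beta * C) in H by (rewrite Hlb; ring).
  match goal with |- Rbar_le _ (Rbar_mult _ (Lub_Rbar ?S)) => set (E := S) end.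
  destruct (Lub_Rbar_correct E) as [Hub _].
  assert (Ea : Rbar_le (norm (ext T a t v)) (Lub_Rbar E)).
  { apply Hub. exists a. split; [easy|]. split; [|easy].
    rewrite Rabs_left1; lra. }
  assert (Eb : Rbar_le (norm (ext T b t v)) (Lub_Rbar E)).
  { apply Hub. exists b. split; [easy|]. split; [|easy].
    rewrite Rabs_pos_eq; lra. }
  destruct (Lub_Rbar E) as [s| |]; simpl in *.
  - set (x := exp (- beta * C)) in *. assert (0 < x) by apply exp_pos.
    assert (L * (x * norm (ext T a t v) + x * norm (ext T b t v)) <= L * (x * s + x * s)).
    { apply Rmult_le_compat_l; [lra|]. nra. }
    assert (0 <= s) by (pose proof (norm_ge_0 (ext T a t v)); lra).
    nra.
  - destruct (Rle_dec 0 (1 / 2)) as [h1|]; [|lra].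
    destruct (Rle_lt_or_eq_dec 0 (1 / 2) h1); [easy|lra].
  - easy.
Qed.

(** Trades the extended-real supremum for an arbitrary real upper bound [B]. The bound is needed
    only at times from [a0s] on, because the window around [t] does not reach before [a0s]. *)
Lemma noncritical_bound (theta C : R) : 0 < theta ->
  (forall (v : X) (t : R), Rbar_lt a0 t -> exp C * h a0s <= h t ->
     Rbar_le (norm v)
       (Rbar_mult theta
          (Lub_Rbar (fun r => exists u : R, Rbar_lt a0 u /\
                       Rabs (ln (h u) - ln (h t)) <= C /\ r = norm (ext T u t v))))) ->
  forall (v : X) (t B : R), a0s <= t -> ln (h a0s) + C <= ln (h t) ->
    (forall u, a0s <= u -> Rabs (ln (h u) - ln (h t)) <= C -> norm (ext T u t v) <= B) ->
    norm v <= theta * B.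
Proof.
  intros Hth H v t B Jt Ht HB.
  assert (Hdom : exp C * h a0s <= h t).
  { rewrite <- (exp_ln (h a0s)), <- (exp_ln (h t)), <- exp_plus by (apply h_pos; lra).
    apply exp_le_exp. lra. }
  specialize (H v t (domain_of_le t Jt) Hdom).
  match type of H with Rbar_le _ (Rbar_mult _ (Lub_Rbar ?S)) => set (E := S) in * end.
  assert (Hlub : Rbar_le (Lub_Rbar E) B).
  { apply Lub_Rbar_correct. intros r [u [Hu [Hut ->]]]. simpl.
    assert (Ju : a0s <= u).
    { apply h_le_inv; [easy|]. apply Rabs_le_between in Hut.
      pose proof (proj1 hh u Hu). pose proof (h_pos a0s (Rle_refl _)).
      rewrite <- (exp_ln (h a0s)), <- (exp_ln (h u)) by easy. apply exp_le_exp. lra. }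
    now apply HB. }
  destruct (Lub_Rbar E) as [s| |]; simpl in *.
  - nra.
  - easy.
  - destruct (Rle_dec 0 theta) as [h1|]; [|lra].
    destruct (Rle_lt_or_eq_dec 0 theta h1); [easy|lra].
Qed.

(** * Bounded orbits, and a common escape time for unbounded ones *)

Lemma bounded_orbits_iff (v : X) :
  bounded_orbits T a0s v <-> exists B, forall t, a0s <= t -> norm (T t a0s v) <= B.
Proof.
  unfold bounded_orbits.
  set (E := fun r => exists t, a0s <= t /\ r = norm (T t a0s v)).
  destruct (Lub_Rbar_correct E) as [Hub Hlub]. split.
  - intros H. assert (H0 : Rbar_le (norm (T a0s a0s v)) (Lub_Rbar E)).
    { apply Hub. exists a0s. split; [lra|easy]. }
    destruct (Lub_Rbar E) as [B| |]; try easy.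
    exists B. intros t Ht. apply (Hub (norm (T t a0s v))). now exists t.
  - intros [B HB]. apply Rbar_le_lt_trans with (Finite B); [|easy].
    apply Hlub. intros r [t [Ht ->]]. now apply HB.
Qed.

Lemma bounded_orbits_plus (v w : X) :
  bounded_orbits T a0s v -> bounded_orbits T a0s w -> bounded_orbits T a0s (plus v w).
Proof.
  rewrite !bounded_orbits_iff. intros [B HB] [B' HB']. exists (B + B').
  intros t Ht. rewrite (evolution_plus a0) by easy.
  eapply Rle_trans; [apply norm_triangle|]. specialize (HB t Ht). specialize (HB' t Ht). lra.
Qed.

Lemma bounded_orbits_scal (c : K) (v : X) :
  bounded_orbits T a0s v -> bounded_orbits T a0s (scal c v).
Proof.
  rewrite !bounded_orbits_iff. intros [B HB]. exists (abs c * B).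
  intros t Ht. rewrite (evolution_scal a0) by easy.
  eapply Rle_trans; [apply norm_scal|]. apply Rmult_le_compat_l; [apply abs_ge_0|auto].
Qed.

(* Compactness of the unit sphere of [span l]: otherwise unit vectors [z n] with
   orbits bounded by [A] on [[a0s, a0s + n]] would accumulate at a unit vector with
   bounded orbit. *)
Lemma unbounded_orbits_uniform (l : list X) (A : R) :
  (forall z, span l z -> bounded_orbits T a0s z -> z = zero) ->
  exists t1, a0s <= t1 /\ forall z, span l z -> z <> zero ->
    exists u, a0s <= u <= t1 /\ A * norm z < norm (T u a0s z).
Proof.
  intros Hl. apply NNPP. intros Hno.
  assert (Hz : forall n : nat, exists z, span l z /\ norm z = 1 /\
             forall u, a0s <= u <= a0s + INR n -> norm (T u a0s z) <= A).
  { intros n. apply NNPP. intros Hn. apply Hno. exists (a0s + INR n).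
    pose proof (pos_INR n). split; [lra|]. intros z Hz Hz0. apply NNPP. intros Hu.
    apply Hn. destruct (exists_normalizing_scalar hK z Hz0) as [c [Hc Hc1]].
    exists (scal c z). split; [now apply span_scal|]. split; [easy|].
    intros u Hu'. apply Rnot_lt_le. intros Hlt. apply Hu. exists u. split; [easy|].
    rewrite (evolution_scal a0), (norm_scal_eq hK) in Hlt by (try easy; lra).
    rewrite (norm_scal_eq hK) in Hc1.
    assert (Hpos : 0 < norm z).
    { destruct (norm_ge_0 z) as [Hp|Hp]; [easy|]. rewrite <- Hp in Hc1. lra. }
    replace (norm (T u a0s z)) with (abs c * norm (T u a0s z) * norm z)
      by (rewrite <- (Rmult_1_r (norm (T u a0s z))) at 2; rewrite <- Hc1; ring).
    now apply Rmult_lt_compat_r. }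
  set (z := fun n => proj1_sig (constructive_indefinite_description _ (Hz n))).
  assert (Hs : forall n, span l (z n) /\ norm (z n) = 1 /\
             forall u, a0s <= u <= a0s + INR n -> norm (T u a0s (z n)) <= A).
  { intros n. exact (proj2_sig (constructive_indefinite_description _ (Hz n))). }
  destruct (span_bounded_subseq hK l z 1) as [phi [y [Hphi [Hy Hlim]]]].
  { apply Hs. }
  { intros n. right. apply Hs. }
  assert (H1 : 1 <= norm y).
  { apply (is_lim_seq_le (fun _ => 1) (fun n => norm y + norm (minus (z (phi n)) y)) 1 (norm y)).
    - intros n. destruct (Hs (phi n)) as [_ [<- _]]. apply norm_le_minus.
    - apply is_lim_seq_const.
    - replace (Finite (norm y)) with (Finite (norm y + 0)) by (f_equal; ring).
      apply is_lim_seq_plus'; [apply is_lim_seq_const|easy]. }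
  rewrite (Hl y Hy), norm_zero in H1; [lra|].
  apply bounded_orbits_iff. exists A. intros u Hu.
  destruct (linear_norm _ (proj1 hT u a0s ha0s Hu)) as [M [_ HM]].
  apply (is_lim_seq_le_loc (fun _ => norm (T u a0s y))
           (fun n => A + M * norm (minus (z (phi n)) y)) (norm (T u a0s y)) A).
  (* Once the index exceeds [u - a0s], the bound [A] on the orbit of [z] covers the time [u];
     boundedness of [T u a0s] carries it over to [y]. *)
  - destruct (nfloor_ex (u - a0s)) as [N HN]; [lra|].
    apply (Hphi (fun m => norm (T u a0s y) <= A + M * norm (minus (z m) y))).
    exists (S N). intros n Hn. apply le_INR in Hn. rewrite S_INR in Hn.
    eapply Rle_trans; [apply (norm_le_minus _ (T u a0s (z n)))|].
    apply Rplus_le_compat; [apply Hs; lra|].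
    rewrite norm_minus_sym, <- additive_minus
      by (intros; now apply (evolution_plus a0)). apply HM.
  - apply is_lim_seq_const.
  - replace (Finite A) with (Finite (A + M * 0)) by (f_equal; ring).
    apply is_lim_seq_plus'; [apply is_lim_seq_const|].
    apply is_lim_seq_mult'; [apply is_lim_seq_const|easy].
Qed.

(** Merges growth and decay into one estimate valid for either order of [t] and [s]; the added [1]
    in the constant ensures [1 <= M]. *)
Lemma ext_bound :
  bounded_growth h T (fun t => a0s <= t) -> bounded_decay h T (fun t => a0s <= t) ->
  exists M mu, 1 <= M /\ 0 < mu /\ forall t s v, a0s <= t -> a0s <= s ->
    norm (ext T t s v) <= M * exp (mu * Rabs (ln (h t) - ln (h s))) * norm v.
Proof.
  intros [M1 [mu1 [HM1 [Hmu1 H1]]]] [M2 [mu2 [HM2 [Hmu2 H2]]]].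
  exists (M1 + M2 + 1), (mu1 + mu2). split; [lra|]. split; [lra|].
  intros t s v Jt Js. pose proof (h_pos t Jt). pose proof (h_pos s Js).
  set (d := Rabs (ln (h t) - ln (h s))).
  assert (Hd : 0 <= d) by apply Rabs_pos.
  assert (Hstep : exists N nu, 0 <= N <= M1 + M2 + 1 /\ nu <= mu1 + mu2 /\
            norm (ext T t s v) <= N * exp (nu * d) * norm v).
  { assert (Hlin : forall c w, ext T t s (scal c w) = scal c (ext T t s w)).
    { intros c w. apply (ext_scal a0); try easy; now apply domain_of_le. }
    destruct (Rle_dec s t) as [Hst|Hst].
    - exists M1, mu1. split; [lra|]. split; [lra|].
      specialize (H1 t s Jt Js Hst). rewrite Rpower_ratio in H1 by easy.
      rewrite <- (ext_le T) in H1 by easy.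
      assert (Hln := ln_h_le s t Js Hst).
      replace d with (ln (h t) - ln (h s)) by (unfold d; rewrite Rabs_pos_eq; lra).
      exact (opnorm_bound hK _ _ Hlin H1 v).
    - exists M2, mu2. split; [lra|]. split; [lra|].
      specialize (H2 t s Jt Js ltac:(lra)). rewrite Rpower_ratio in H2 by easy.
      assert (Hln := ln_h_le t s Jt ltac:(lra)).
      replace d with (ln (h s) - ln (h t)) by (unfold d; rewrite Rabs_left1; lra).
      exact (opnorm_bound hK _ _ Hlin H2 v). }
  destruct Hstep as [N [nu [HN [Hnu Hb]]]].
  eapply Rle_trans; [exact Hb|]. apply Rmult_le_compat_r; [apply norm_ge_0|].
  apply Rmult_le_compat; [lra|left; apply exp_pos|lra|].
  apply exp_le_exp. now apply Rmult_le_compat_r.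
Qed.

(** * Orbits in logarithmic time *)

Section Noncritical.

(* [phi] is the inverse of [t |-> ln (h t)]; in the time [ln (h t)] the rate [h]
   becomes the exponential and noncriticality refers to windows of fixed length. *)
Variable phi : R -> R.
Hypothesis hphi : forall x, Rbar_lt a0 (phi x) /\ h (phi x) = exp x.
Variables (M mu theta C : R).
Hypothesis M_ge1 : 1 <= M.
Hypothesis mu_pos : 0 < mu.
Hypothesis ext_growth : forall t s v, a0s <= t -> a0s <= s ->
  norm (ext T t s v) <= M * exp (mu * Rabs (ln (h t) - ln (h s))) * norm v.
Hypothesis theta01 : 0 < theta < 1.
Hypothesis C_pos : 0 < C.
Hypothesis noncritical : forall (v : X) (t B : R),
  a0s <= t -> ln (h a0s) + C <= ln (h t) ->
  (forall u, a0s <= u -> Rabs (ln (h u) - ln (h t)) <= C -> norm (ext T u t v) <= B) ->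
  norm v <= theta * B.

(** In the results on noncritical functions, [orbit z] plays the role of [f], [x0] that of [t0], and
    [E] bounds the growth over a logarithmic time [C]. *)
Let x0 := ln (h a0s).
Let E := M * exp (mu * C).
Let orbit (z : X) (x : R) : R := norm (ext T (phi x) a0s z).

Lemma phi_ge (x : R) : x0 <= x -> a0s <= phi x.
Proof.
  intros Hx. apply h_le_inv; [apply hphi|]. rewrite (proj2 (hphi x)).
  rewrite <- (exp_ln (h a0s)) by (apply h_pos; lra). now apply exp_le_exp.
Qed.

Lemma ln_h_phi (x : R) : ln (h (phi x)) = x.
Proof.
  rewrite (proj2 (hphi x)). apply ln_exp.
Qed.

Lemma phi_ln_h (t : R) : a0s <= t -> phi (ln (h t)) = t.
Proof.
  intros Jt. pose proof (h_pos t Jt).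
  assert (Hh : h (phi (ln (h t))) = h t) by (rewrite (proj2 (hphi _)); now apply exp_ln).
  apply Rle_antisym; apply h_le_inv; try (rewrite Hh; lra).
  - now apply domain_of_le.
  - apply hphi.
Qed.

Lemma E_ge1 : 1 <= E.
Proof.
  unfold E. assert (1 <= exp (mu * C)) by (rewrite <- exp_0; apply exp_le_exp; nra). nra.
Qed.

Lemma orbit_pos (z : X) (x : R) : 0 <= orbit z x.
Proof.
  apply norm_ge_0.
Qed.

Lemma orbit_ln_h (z : X) (t : R) : a0s <= t -> orbit z (ln (h t)) = norm (ext T t a0s z).
Proof.
  intros Jt. unfold orbit. now rewrite phi_ln_h.
Qed.

Lemma orbit_step (z : X) (x y : R) : x0 <= x -> x0 <= y ->
  orbit z y <= M * exp (mu * Rabs (y - x)) * orbit z x.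
Proof.
  intros Hx Hy. pose proof (phi_ge x Hx) as Jx. pose proof (phi_ge y Hy) as Jy.
  unfold orbit. rewrite <- (ext_comp a0 T hT hTinv (phi y) (phi x) a0s) by (try apply hphi; easy).
  eapply Rle_trans; [now apply ext_growth|]. rewrite !ln_h_phi. lra.
Qed.

Lemma orbit_growth (z : X) (x y : R) : x0 <= x -> x0 <= y -> Rabs (y - x) <= C ->
  orbit z y <= E * orbit z x.
Proof.
  intros Hx Hy Hxy. eapply Rle_trans; [apply (orbit_step z x y); easy|].
  apply Rmult_le_compat_r; [apply orbit_pos|]. apply Rmult_le_compat_l; [lra|].
  apply exp_le_exp. apply Rmult_le_compat_l; lra.
Qed.

Lemma orbit_noncritical (z : X) (x B : R) : x0 + C <= x ->
  (forall y, Rabs (y - x) <= C -> orbit z y <= B) -> orbit z x <= theta * B.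
Proof.
  intros Hx HB. pose proof (phi_ge x ltac:(lra)) as Jx. unfold orbit at 1.
  apply noncritical with (phi x); [easy|rewrite ln_h_phi; exact Hx|].
  intros u Ju Hu. rewrite ln_h_phi in Hu. specialize (HB _ Hu).
  rewrite orbit_ln_h in HB by easy.
  rewrite (ext_comp a0) by (try apply hphi; try easy; now apply domain_of_le). exact HB.
Qed.

Lemma stable_decay (z : X) (s t : R) : bounded_orbits T a0s z -> a0s <= s -> s <= t ->
  norm (ext T t a0s z)
  <= E / theta * exp (- (- ln theta / C) * (ln (h t) - ln (h s))) * norm (ext T s a0s z).
Proof.
  rewrite bounded_orbits_iff. intros [B HB] Js Hst.
  rewrite <- !orbit_ln_h by lra.
  apply (bounded_exp_decay (orbit z) x0 theta C E (orbit_pos z) theta01 C_pos E_ge1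
           (orbit_growth z) (orbit_noncritical z) B).
  - intros x Hx. pose proof (phi_ge x Hx). unfold orbit. rewrite ext_le by easy. now apply HB.
  - apply ln_h_le; lra.
  - now apply ln_h_le.
Qed.

Lemma unstable_growth (l : list X) :
  (forall z, span l z -> bounded_orbits T a0s z -> z = zero) ->
  exists D, 0 < D /\ forall z t s, span l z -> a0s <= t -> t <= s ->
    norm (ext T t a0s z)
    <= D * exp (- (- ln theta / C) * (ln (h s) - ln (h t))) * norm (ext T s a0s z).
Proof.
  intros Hl.
  (* The threshold is the one required by [unbounded_exp_growth]. Since [t1] serves all of [span l],
     the resulting constant does not depend on [z]. *)
  destruct (unbounded_orbits_uniform l (E * E / theta) Hl) as [t1 [Ht1 Hunif]].
  set (x1 := ln (h t1)).
  assert (Hx1 : x0 <= x1) by (apply ln_h_le; lra).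
  (* Bounds the backward evolution to [x0] from any logarithmic time in [[x0, x1]]. *)
  set (G := M * exp (mu * (x1 - x0))).
  assert (HG : 1 <= G).
  { unfold G. assert (1 <= exp (mu * (x1 - x0))) by (rewrite <- exp_0; apply exp_le_exp; nra).
    nra. }
  pose proof E_ge1 as HE.
  exists (E * G / theta * exp ((- ln theta / C) * (x1 - x0))). split.
  { apply Rmult_lt_0_compat; [|apply exp_pos]. apply Rdiv_lt_0_compat; nra. }
  intros z t s Hz Jt Hts.
  destruct (excluded_middle_informative (z = zero)) as [->|Hz0].
  { rewrite !(additive_zero (ext T _ a0s))
      by (intros; apply (ext_plus a0); try easy; apply domain_of_le; lra).
    rewrite norm_zero. lra. }
  rewrite <- !orbit_ln_h by lra.
  apply (unbounded_exp_growth (orbit z) x0 theta C E (orbit_pos z) theta01 C_pos HE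
           (orbit_growth z) (orbit_noncritical z) x1 G Hx1 HG).
  - intros x Hx. eapply Rle_trans; [apply (orbit_step z x x0); lra|].
    apply Rmult_le_compat_r; [apply orbit_pos|]. unfold G.
    apply Rmult_le_compat_l; [lra|]. apply exp_le_exp.
    apply Rmult_le_compat_l; [lra|]. rewrite Rabs_left1; lra.
  - destruct (Hunif z Hz Hz0) as [u [Hu Huz]]. exists (ln (h u)). split.
    + split; apply ln_h_le; lra.
    + unfold x0. rewrite !orbit_ln_h, (ext_refl a0 T hT), ext_le by (try easy; lra). exact Huz.
  - apply ln_h_le; lra.
  - apply ln_h_le; lra.
Qed.

End Noncritical.

(** * A dichotomy from a splitting with two exponential rates *)

Section Splitting.

Variables (S Z : X -> Prop) (D lambda M mu : R).
Hypothesis S_plus : forall (v w : X), S v -> S w -> S (plus v w).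
Hypothesis S_scal : forall (c : K) (v : X), S v -> S (scal c v).
Hypothesis Z_plus : forall (v w : X), Z v -> Z w -> Z (plus v w).
Hypothesis Z_scal : forall (c : K) (v : X), Z v -> Z (scal c v).
Hypothesis S_Z_sum : direct_sum S Z.
Hypothesis D_pos : 0 < D.
Hypothesis lambda_pos : 0 < lambda.
Hypothesis S_decay : forall z t s, S z -> a0s <= s -> s <= t ->
  norm (ext T t a0s z) <= D * exp (- lambda * (ln (h t) - ln (h s))) * norm (ext T s a0s z).
Hypothesis Z_growth : forall z t s, Z z -> a0s <= t -> t <= s ->
  norm (ext T t a0s z) <= D * exp (- lambda * (ln (h s) - ln (h t))) * norm (ext T s a0s z).
Hypothesis M_pos : 0 < M.
Hypothesis ext_growth : forall t s v, a0s <= t -> a0s <= s ->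
  norm (ext T t s v) <= M * exp (mu * Rabs (ln (h t) - ln (h s))) * norm v.

(* The angle between the images of [S] and [Z] stays bounded away from zero: after a
   fixed time the two components of [v] have very different sizes, while [v] itself has
   been stretched by a bounded factor only. *)
Lemma unstable_component_bound :
  exists Q, 0 < Q /\ forall t z1 z2, a0s <= t -> S z1 -> Z z2 ->
    norm (ext T t a0s z2) <= Q * norm (plus (ext T t a0s z1) (ext T t a0s z2)).
Proof.
  (* After logarithmic time [sigma], the stable component has at most half its size and the unstable
     one at least twice its size. *)
  set (sigma := Rabs (ln (2 * D)) / lambda).
  pose proof (Rabs_pos (ln (2 * D))).
  assert (Hsigma : 0 <= sigma) by (apply Rdiv_le_0_compat; lra).
  set (q := D * exp (- lambda * sigma)).
  assert (Hq : 0 < q <= 1 / 2).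
  { pose proof (exp_pos (- lambda * sigma)). split; [unfold q; nra|].
    assert (2 * D * exp (- lambda * sigma) <= 1); [|unfold q; lra].
    rewrite <- (exp_ln (2 * D)) by lra. rewrite <- exp_plus, <- exp_0. apply exp_le_exp.
    unfold sigma. pose proof (Rle_abs (ln (2 * D))).
    replace (- lambda * (Rabs (ln (2 * D)) / lambda)) with (- Rabs (ln (2 * D)))
      by (field; lra). lra. }
  set (W := M * exp (mu * sigma)).
  assert (HW : 0 < W) by (apply Rmult_lt_0_compat; [easy|apply exp_pos]).
  exists (W + 1). split; [lra|].
  intros t z1 z2 Jt H1 H2.
  destruct (proj2 (proj2 hh) (exp (ln (h t) + sigma)) (exp_pos _)) as [t' [Dt' Ht']].
  assert (Hln : ln (h t') = ln (h t) + sigma) by (rewrite Ht'; apply ln_exp).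
  assert (Htt' : t <= t').
  { apply h_le_inv; [easy|]. rewrite Ht', <- (exp_ln (h t)) at 1 by now apply h_pos.
    apply exp_le_exp. lra. }
  pose proof (domain_of_le t Jt) as Dt.
  pose proof (S_decay z1 t' t H1 Jt Htt') as HS1.
  pose proof (Z_growth z2 t t' H2 Jt Htt') as HZ1.
  replace (ln (h t') - ln (h t)) with sigma in HS1, HZ1 by lra. fold q in HS1, HZ1.
  pose proof (ext_growth t' t (plus (ext T t a0s z1) (ext T t a0s z2)) ltac:(lra) Jt) as Hg.
  rewrite (ext_plus a0), !(ext_comp a0) in Hg by easy.
  rewrite Hln, Rabs_pos_eq in Hg by lra.
  replace (ln (h t) + sigma - ln (h t)) with sigma in Hg by ring. fold W in Hg.
  pose proof (norm_le_plus (ext T t' a0s z1) (ext T t' a0s z2)) as N1.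
  pose proof (norm_le_plus (ext T t a0s z2) (ext T t a0s z1)) as N2.
  rewrite (plus_comm (ext T t a0s z2)) in N2.
  pose proof (norm_ge_0 (ext T t a0s z1)). pose proof (norm_ge_0 (ext T t' a0s z2)).
  pose proof (norm_ge_0 (plus (ext T t a0s z1) (ext T t a0s z2))).
  set (v := norm (plus (ext T t a0s z1) (ext T t a0s z2))) in *.
  (* Write [a], [b] for the norms of the two components at [t] and [a'], [b'] at [t']. From
     [a' <= a / 2], [b <= b' / 2], [b' <= W * v + a'] and [a <= b + v] one gets
     [3 / 2 * b <= (W + 1 / 2) * v]. *)
  assert (norm (ext T t' a0s z1) <= 1 / 2 * norm (ext T t a0s z1)) by nra.
  assert (norm (ext T t a0s z2) <= 1 / 2 * norm (ext T t' a0s z2)) by nra.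
  nra.
Qed.

(** Linearity follows from the uniqueness of the decomposition. No bound on [P0] is claimed here:
    boundedness, even at time [a0s], comes from [unstable_component_bound]. *)
Lemma exists_stable_projection : exists P0 : X -> X,
  (forall v, S (P0 v)) /\ (forall v, Z (minus v (P0 v))) /\
  (forall v a, S a -> Z (minus v a) -> P0 v = a) /\
  (forall v w, P0 (plus v w) = plus (P0 v) (P0 w)) /\
  (forall (c : K) (v : X), P0 (scal c v) = scal c (P0 v)).
Proof.
  destruct S_Z_sum as [Hsum Hdisj].
  assert (Hex : forall v, exists a, S a /\ Z (minus v a)).
  { intros v. destruct (Hsum v) as [a [b [Ha [Hb ->]]]]. exists a. split; [easy|].
    now rewrite minus_plus_l. }
  set (P0 := fun v => proj1_sig (constructive_indefinite_description _ (Hex v))).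
  assert (HP0 : forall v, S (P0 v) /\ Z (minus v (P0 v))).
  { intros v. exact (proj2_sig (constructive_indefinite_description _ (Hex v))). }
  assert (Huniq : forall v a, S a -> Z (minus v a) -> P0 v = a).
  { intros v a Ha Hb. destruct (HP0 v) as [H1 H2].
    assert (Hd : minus (P0 v) a = zero).
    { apply Hdisj.
      - rewrite minus_scal_opp. apply S_plus; [easy|]. now apply S_scal.
      - rewrite <- (minus_minus v), minus_scal_opp. apply Z_plus; [easy|]. now apply Z_scal. }
    rewrite <- (plus_minus a (P0 v)), Hd. apply plus_zero_r. }
  exists P0. split; [apply HP0|]. split; [apply HP0|]. split; [exact Huniq|]. split.
  - intros v w. apply Huniq; [apply S_plus; apply HP0|].
    rewrite minus_plus_plus. apply Z_plus; apply HP0.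
  - intros c v. apply Huniq; [apply S_scal; apply HP0|].
    apply (eq_ind _ Z (Z_scal c _ (proj2 (HP0 v)))). apply scal_minus_r_normed.
Qed.

Lemma dichotomy_of_splitting : dichotomy h T (fun t => a0s <= t).
Proof.
  destruct exists_stable_projection as [P0 [HPS [HPZ [Huniq [Hplus Hscal]]]]].
  destruct unstable_component_bound as [Q [HQ Hcomp]].
  (* Transporting [P0] along the evolution makes commutation with [T] a consequence of
     [ext_comp]. *)
  set (P := fun t v => ext T t a0s (P0 (ext T a0s t v))).
  assert (Hminus : forall t v, a0s <= t ->
            minus v (P t v)
            = ext T t a0s (minus (ext T a0s t v) (P0 (ext T a0s t v)))).
  { intros t v Jt. pose proof (domain_of_le t Jt).
    rewrite (ext_minus a0), (ext_comp a0), (ext_refl a0) by easy. reflexivity. }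
  assert (Hcompl : forall t v, a0s <= t -> norm (minus v (P t v)) <= Q * norm v).
  { intros t v Jt. rewrite Hminus by easy.
    eapply Rle_trans; [apply (Hcomp t (P0 (ext T a0s t v))); try easy|].
    rewrite <- Hminus by easy. fold (P t v). rewrite plus_minus. lra. }
  assert (HPbound : forall t v, a0s <= t -> norm (P t v) <= (Q + 1) * norm v).
  { intros t v Jt. specialize (Hcompl t v Jt).
    pose proof (norm_le_minus (P t v) v). rewrite norm_minus_sym in Hcompl. lra. }
  assert (Hproj : forall t, a0s <= t -> projection (P t)).
  { intros t Jt. pose proof (domain_of_le t Jt). split; [split|].
    - intros v w. unfold P. now rewrite (ext_plus a0), Hplus, (ext_plus a0).
    - intros c v. unfold P. now rewrite (ext_scal a0), Hscal, (ext_scal a0).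
    - exists (Q + 1). split; [lra|]. intros v. now apply HPbound.
    - intros v. unfold P. rewrite (ext_comp a0), (ext_refl a0) by easy. f_equal.
      apply Huniq; [easy|]. rewrite minus_eq_zero_normed.
      (* That [zero] lies in [Z] is obtained by scaling a vector of [Z] by zero. *)
      rewrite <- (scal_zero_normed (minus v (P0 v))). now apply Z_scal. }
  assert (Hcomm : forall t s v, a0s <= s -> s <= t -> P t (T t s v) = T t s (P s v)).
  { intros t s v Js Hst.
    assert (Jt : a0s <= t) by lra. pose proof (domain_of_le t Jt). pose proof (domain_of_le s Js).
    unfold P. rewrite <- (ext_le T t s) by easy. now rewrite !(ext_comp a0). }
  (* The rate constant [D] is multiplied by a bound on the projections: [Q + 1] for [P s], and [Q]
     for its complement. *)
  exists P, (D * (Q + 1)), lambda.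
  split; [apply Rmult_lt_0_compat; lra|]. split; [easy|]. split; [exact Hproj|].
  assert (Hker : forall t s, a0s <= s -> s <= t ->
            maps_bijectively (Ker (P s)) (Ker (P t)) (T t s)).
  { intros t s Js Hst.
    assert (Jt : a0s <= t) by lra. pose proof (domain_of_le t Jt). pose proof (domain_of_le s Js).
    assert (Hz : T t s zero = zero)
      by (apply additive_zero; intros; now apply (evolution_plus a0)).
    split.
    - intros v Hv. unfold Ker in *. now rewrite Hcomm, Hv.
    - intros w Hw. unfold Ker in *.
      assert (Hs : T t s (ext T s t w) = w).
      { rewrite <- (ext_le T t s), (ext_comp a0), (ext_refl a0) by easy. reflexivity. }
      exists (ext T s t w). split; [split; [|easy]|].
      + apply (evolution_inj a0 T hTinv t s); [easy|easy|]. now rewrite <- Hcomm, Hs, Hz.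
      + intros u [_ Hu]. apply (evolution_inj a0 T hTinv t s); [easy|easy|]. now rewrite Hu. }
  split; [|split].
  - intros t s Jt Js Hst. split; [intros v; now apply Hcomm|now apply Hker].
  - intros t s Jt Js Hst. rewrite Rpower_ratio by now apply h_pos.
    pose proof (exp_pos (- lambda * (ln (h t) - ln (h s)))).
    apply opnorm_le; [left; repeat apply Rmult_lt_0_compat; lra|]. intros v.
    pose proof (S_decay (P0 (ext T a0s s v)) t s (HPS _) Js Hst) as Hd. fold (P s v) in Hd.
    rewrite <- (ext_comp a0 T hT hTinv t s a0s) in Hd by (try easy; now apply domain_of_le).
    fold (P s v) in Hd. rewrite ext_le in Hd by easy.
    eapply Rle_trans; [exact Hd|].
    apply Rle_trans with (D * exp (- lambda * (ln (h t) - ln (h s))) * ((Q + 1) * norm v)).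
    + apply Rmult_le_compat_l; [nra|]. now apply HPbound.
    + right. ring.
  - intros t s Jt Js Hts. rewrite Rpower_ratio by now apply h_pos.
    pose proof (exp_pos (- lambda * (ln (h s) - ln (h t)))).
    apply opnorm_le; [left; repeat apply Rmult_lt_0_compat; lra|]. intros v.
    pose proof (domain_of_le t Jt) as Dt. pose proof (domain_of_le s Js) as Ds.
    rewrite (inverse_on_Ker a0 T hT hTinv P t s v Dt Hts (Hproj t Jt))
      by (intros; now apply Hcomm).
    rewrite Hminus, (ext_comp a0) by easy.
    eapply Rle_trans; [apply (Z_growth _ t s (HPZ _) Jt Hts)|].
    rewrite <- Hminus by easy.
    apply Rle_trans with (D * exp (- lambda * (ln (h s) - ln (h t))) * (Q * norm v)).
    + apply Rmult_le_compat_l; [nra|]. now apply Hcompl.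
    + pose proof (norm_ge_0 v).
      assert (0 <= D * exp (- lambda * (ln (h s) - ln (h t)))) by nra. nra.
Qed.

End Splitting.

Lemma noncritical_dichotomy :
  bounded_growth h T (fun t => a0s <= t) -> bounded_decay h T (fun t => a0s <= t) ->
  (exists Z : X -> Prop, finite_dim_subspace Z /\ direct_sum (bounded_orbits T a0s) Z) ->
  uniformly_noncritical a0 h T a0s -> dichotomy h T (fun t => a0s <= t).
Proof.
  intros Hgrowth Hdecay [Z [[l HZ] Hsum]] [theta [C [Htheta [HC Hnc]]]].
  destruct (ext_bound Hgrowth Hdecay) as [M [mu [HM [Hmu Hext]]]].
  assert (Hphi : exists phi : R -> R, forall x, Rbar_lt a0 (phi x) /\ h (phi x) = exp x).
  { exists (fun x => proj1_sig (constructive_indefinite_description _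
                      (proj2 (proj2 hh) (exp x) (exp_pos x)))).
    intros x. exact (proj2_sig (constructive_indefinite_description _
                      (proj2 (proj2 hh) (exp x) (exp_pos x)))). }
  destruct Hphi as [phi Hphi].
  pose proof (noncritical_bound theta C (proj1 Htheta) Hnc) as Hnon.
  destruct (unstable_growth phi Hphi M mu theta C HM Hmu Hext Htheta HC Hnon l) as [D2 [HD2 HU]].
  { intros z Hz Hb. apply (proj2 Hsum); [easy|]. now apply HZ. }
  set (D1 := M * exp (mu * C) / theta).
  assert (HD1 : 0 < D1).
  { apply Rdiv_lt_0_compat; [|lra]. apply Rmult_lt_0_compat; [lra|apply exp_pos]. }
  assert (Hlambda : 0 < - ln theta / C).
  { apply Rdiv_lt_0_compat; [|easy]. rewrite <- Ropp_0. apply Ropp_lt_contravar.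
    rewrite <- ln_1. apply ln_increasing; lra. }
  (* [D1] is the constant of [stable_decay] and [D2] that of [unstable_growth]; their sum serves
     both rates. *)
  apply (dichotomy_of_splitting (bounded_orbits T a0s) Z (D1 + D2) (- ln theta / C) M mu);
    try easy; try lra.
  - exact bounded_orbits_plus.
  - exact bounded_orbits_scal.
  - intros v w. rewrite !HZ. apply span_plus.
  - intros c v. rewrite !HZ. apply span_scal.
  - intros z t s Hz Js Hst.
    eapply Rle_trans; [apply (stable_decay phi Hphi M mu theta C HM Hmu Hext Htheta HC Hnon z s t);
      easy|].
    apply Rmult_le_compat_r; [apply norm_ge_0|].
    apply Rmult_le_compat_r; [left; apply exp_pos|]. fold D1. lra.
  - intros z t s Hz Jt Hts.
    eapply Rle_trans; [apply (HU z t s); [now apply HZ|easy|easy]|].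
    apply Rmult_le_compat_r; [apply norm_ge_0|].
    apply Rmult_le_compat_r; [left; apply exp_pos|]. lra.
Qed.

End EvolutionWithRate.

Theorem theorem2 (K : AbsRing) (hK : K = R_AbsRing \/ K = C_AbsRing)
    (X : CompleteNormedModule K)
    (a0 : Rbar) (ha0 : Rbar_lt a0 p_infty)
    (T : R -> R -> X -> X)
    (hT : evolution_family a0 T) (hTinv : invertible_family a0 T)
    (h : R -> R) (hh : growth_rate a0 h)
    (a0s : R) (ha0s : Rbar_lt a0 a0s)
    (hgrowth : bounded_growth h T (fun t => a0s <= t))
    (hdecay : bounded_decay h T (fun t => a0s <= t))
    (hsplit : exists Z : X -> Prop,
        finite_dim_subspace Z /\ direct_sum (bounded_orbits T a0s) Z) :
  (dichotomy h T (fun t => a0s <= t) <-> expansive h T (fun t => a0s <= t)) /\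
  (expansive h T (fun t => a0s <= t) <-> uniformly_noncritical a0 h T a0s).
Proof.
  assert (hK' : locally_compact_valued_field K).
  { destruct hK as [->| ->]; [exact R_locally_compact|exact C_locally_compact]. }
  assert (Hab : dichotomy h T (fun t => a0s <= t) -> expansive h T (fun t => a0s <= t))
    by now apply (dichotomy_expansive hK' a0).
  assert (Hbc : expansive h T (fun t => a0s <= t) -> uniformly_noncritical a0 h T a0s)
    by now apply expansive_noncritical.
  assert (Hca : uniformly_noncritical a0 h T a0s -> dichotomy h T (fun t => a0s <= t))
    by now apply (noncritical_dichotomy hK').
  tauto.
Qed.
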